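(* Let $\boldsymbol{S}=\{S_1,S_2\}\subset\mathbb{R}^{d\times d}$ be such that there exists a symmetric positive-definite matrix $P\in\mathbb{R}^{d\times d}$ with $P-S_k^TPS_k\ge0$ for $k=1,2$, and suppose the generalized spectral radius satisfies $\rho(\boldsymbol{S})=1$. Then: (1) if $d=2$, then $1=\max\left\{\rho(S_1),\rho(S_2),\sqrt{\rho(S_1S_2)}\right\}$; (2) if $d=3$, then $1=\max\left\{\sqrt[n]{\rho(S_{w_n}\cdots S_{w_1})}\;\middle|\;w\in\{1,2\}^n,\ n=1,2,3,4,5,6,8\right\}$.
   Context: $\rho(A)$ is the spectral radius of a matrix $A$; for a symmetric matrix $A$, $A\ge0$ means $x^TAx\ge0$ for all $x$. The generalized spectral radius of $\boldsymbol{S}=\{S_1,S_2\}$ is $$\rho(\boldsymbol{S})=\sup_{n\ge1}\max_{w\in\{1,2\}^n}\sqrt[n]{\rho(S_{w_n}\cdots S_{w_1})}.$$ *)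

(* Defs.v *)
From mathcomp Require Import all_boot all_order all_algebra.
From mathcomp Require Import complex.
From mathcomp Require Import all_classical all_reals all_analysis.

Set Implicit Arguments.
Unset Strict Implicit.
Unset Printing Implicit Defensive.

Import Order.TTheory GRing.Theory Num.Theory.
Local Open Scope classical_set_scope.
Local Open Scope ring_scope.
Local Open Scope complex_scope.

(* The eigenvalues are those of A seen as a complex matrix; [eigenvalue] uses
   row eigenvectors, which gives the same spectrum as column eigenvectors.
   For 0 < d the set is finite and nonempty, so the supremum is a maximum. *)
Definition spectral_radius (R : realType) (d : nat) (A : 'M[R]_d) : R :=
  sup [set ComplexField.Normc.normc z | z in
        [set z : R[i] | eigenvalue (map_mx (real_complex R) A) z]].

(* S_{w_n} ... S_{w_1} for the word w = w_1 ... w_n. *)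
Definition word_prod (R : realType) (d : nat) (I : Type) (S : I -> 'M[R]_d)
  (w : seq I) : 'M[R]_d := \prod_(k <- rev w) S k.

(* For n = 0 the exponent is 0^-1 = 0; only n >= 1 is ever used. The default 0
   of the maximum is harmless since all the values are nonnegative. *)
Definition max_word_radius (R : realType) (d : nat) (I : finType)
    (S : I -> 'M[R]_d) (n : nat) : R :=
  \big[Num.max/0]_(w : n.-tuple I)
    (spectral_radius (word_prod S w) `^ (n%:R^-1)).

(* This set is nonempty and bounded above (by the largest operator norm of the
   S k), so [sup] is a genuine supremum here. *)
Definition generalized_spectral_radius (R : realType) (d : nat) (I : finType)
    (S : I -> 'M[R]_d) : R :=
  sup [set max_word_radius S n | n in [set n : nat | (1 <= n)%N]].

Definition quad_form (R : realType) (d : nat) (A : 'M[R]_d) (x : 'cV[R]_d) : R :=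
  (x^T *m A *m x) 0 0.

Definition symmetric_mx (R : realType) (d : nat) (A : 'M[R]_d) : Prop :=
  A^T = A.

Definition posdef_mx (R : realType) (d : nat) (A : 'M[R]_d) : Prop :=
  forall x : 'cV[R]_d, x != 0 -> 0 < quad_form A x.

Definition nonneg_mx (R : realType) (d : nat) (A : 'M[R]_d) : Prop :=
  forall x : 'cV[R]_d, 0 <= quad_form A x.

(* Main.v *)
Require Import Defs.
From mathcomp Require Import all_boot all_order all_algebra.
From mathcomp Require Import complex.
From mathcomp Require Import all_classical all_reals all_analysis.
From mathcomp Require Import ring lra.

Set Implicit Arguments.
Unset Strict Implicit.
Unset Printing Implicit Defensive.

Import Order.TTheory GRing.Theory Num.Theory.
Import numFieldNormedType.Exports.
Local Open Scope ring_scope.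

(* In the norm x |-> sqrt (x^T P x) every S_k is a contraction, isometric exactly
   on a linear subspace V_k. If all products of some length N contracted strictly,
   compactness of the unit sphere would force the generalized spectral radius
   below 1; so for every N some nonzero x keeps its norm along a word of length N.
   Such a trajectory is at each step in V_j, and in S_i V_i :&: V_j if the
   previous letter was i and the next is j. Unless a product of length 1 or 2
   already preserves some V_i (and then has an eigenvalue of modulus 1), these
   spaces have dimension at most 1, with the possible exception, for d = 3, of one
   pair i <> j. By the pigeonhole principle the trajectory then meets one of the
   lines twice, which gives a short product with eigenvalue 1 or -1; for d = 3
   lengths up to 6 are enough.

   Everything is written for row vectors, on which S_k acts as x |-> x (S_k)^T. *)

(** * The bilinear form attached to [P] *)

Definition rform (R : realType) (d : nat) (P : 'M[R]_d) (x y : 'rV[R]_d) : R :=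
  (x *m P *m y^T) 0 0.

Section RowForm.
Variables (R : realType) (d : nat).
Implicit Types (P A : 'M[R]_d) (x y : 'rV[R]_d).

Lemma rform_quad P x : quad_form P x^T = rform P x x.
Proof. by rewrite /quad_form trmxK. Qed.

Lemma rformDl P x y z : rform P (x + y) z = rform P x z + rform P y z.
Proof. by rewrite /rform !mulmxDl mxE. Qed.

Lemma rformDr P x y z : rform P z (x + y) = rform P z x + rform P z y.
Proof. by rewrite /rform linearD mulmxDr mxE. Qed.

Lemma rformZl P a x y : rform P (a *: x) y = a * rform P x y.
Proof. by rewrite /rform -!scalemxAl mxE. Qed.

Lemma rformZr P a x y : rform P x (a *: y) = a * rform P x y.
Proof. by rewrite /rform linearZ -scalemxAr mxE. Qed.

Lemma rformC P x y : symmetric_mx P -> rform P x y = rform P y x.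
Proof.
move=> sP; rewrite /rform; have <- : (x *m P *m y^T)^T 0 0 = (x *m P *m y^T) 0 0.
  by rewrite mxE.
by rewrite !trmx_mul trmxK sP mulmxA.
Qed.

Lemma rformM P A x : rform P (x *m A) (x *m A) = rform (A *m P *m A^T) x x.
Proof. by rewrite /rform trmx_mul !mulmxA. Qed.

Lemma rformB P A x : rform (P - A) x x = rform P x x - rform A x x.
Proof. by rewrite /rform mulmxBr mulmxBl !mxE. Qed.

Lemma posdef_rform P x : posdef_mx P -> x != 0 -> 0 < rform P x x.
Proof.
move=> pP x0; rewrite -rform_quad; apply: pP.
by apply: contra_neq x0 => /(congr1 trmx); rewrite trmxK trmx0.
Qed.

Lemma posdef_rform_ge0 P x : posdef_mx P -> 0 <= rform P x x.
Proof.
move=> pP; have [->|x0] := eqVneq x 0; first by rewrite /rform !mul0mx mxE.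
exact/ltW/posdef_rform.
Qed.

(* A nonnegative form vanishes at x only if x lies in its radical: otherwise it
   would be negative at x + t (xM) for some small t < 0. *)
Lemma nonneg_rform_eq0 M x :
  symmetric_mx M -> nonneg_mx M -> rform M x x = 0 -> x *m M = 0.
Proof.
move=> sM pM x0; set y := x *m M.
have pR z : 0 <= rform M z z by rewrite -rform_quad.
(* [b] is the squared Euclidean length of [x *m M], so it is enough to show that it vanishes. *)
have bE : rform M x y = \sum_i y 0 i ^+ 2.
  rewrite /rform -/y mxE; apply: eq_bigr => i _.
  by rewrite [y^T i 0]mxE expr2.
have b0 : rform M x y = 0.
  set b := rform M x y; set c := rform M y y.
  have c0 : 0 <= c := pR _.
  have bge : 0 <= b by rewrite /b bE; apply: sumr_ge0 => i _; exact: sqr_ge0.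
  (* The 1 guards against [c = 0]; the form at [x + t *: y] is then a negative multiple of
     [b ^+ 2]. *)
  pose t := - b / (c + 1).
  have := pR (x + t *: y).
  rewrite rformDl !rformDr !rformZl !rformZr (rformC y x sM) x0 -/b -/c.
  have -> : 0 + t * b + (t * b + t * (t * c)) =
            - (b ^+ 2 * (c + 2) / (c + 1) ^+ 2).
    by rewrite /t; field; apply/eqP; lra.
  rewrite oppr_ge0 => h.
  have : b ^+ 2 * (c + 2) <= 0.
    move: h; rewrite pmulr_lle0 // invr_gt0 exprn_gt0 //; lra.
  rewrite pmulr_lle0; last by lra.
  by move=> h2; apply/eqP; rewrite -sqrf_eq0 eq_le h2 sqr_ge0.
apply/rowP => i; rewrite [RHS]mxE; apply/eqP; rewrite -sqrf_eq0.
move: b0; rewrite bE => /psumr_eq0P -> //.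
by move=> j _; exact: sqr_ge0.
Qed.

End RowForm.

(** * Spectral radius and complex eigenvalues in real terms *)

Lemma char_poly_tr (F : comNzRingType) n (A : 'M[F]_n) :
  char_poly A^T = char_poly A.
Proof.
rewrite /char_poly -det_tr; congr (\det _); apply/matrixP => i j.
by rewrite !mxE eq_sym.
Qed.

Section SpectralRadius.
Variables (R : realType) (d : nat).
Implicit Types (P A B V : 'M[R]_d) (x y : 'rV[R]_d).

Lemma eq_spectral_radius A B :
  (forall z : R[i], eigenvalue (map_mx (real_complex R) A) z =
                    eigenvalue (map_mx (real_complex R) B) z) ->
  spectral_radius A = spectral_radius B.
Proof.
move=> AB; rewrite /spectral_radius; apply: (congr1 (@sup R)); apply/seteqP.
split=> _ [z zA <-]; apply: ex_intro2 (erefl _); rewrite /=.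
  by rewrite -AB; exact: zA.
by rewrite AB; exact: zA.
Qed.

Lemma spectral_radius_tr A : spectral_radius A^T = spectral_radius A.
Proof.
apply: eq_spectral_radius => z.
by rewrite !eigenvalue_root_char -map_trmx char_poly_tr.
Qed.

Lemma spectral_radius_ge0 A : 0 <= spectral_radius A.
Proof.
rewrite /spectral_radius; set E := (X in sup X).
(* [sup] takes the value 0 on the empty set and on a set without supremum. *)
have [->|/set0P[r Er]] := eqVneq E set0; first by rewrite sup0.
have [hE|nE] := pselect (has_sup E); last by rewrite sup_out.
have rE : r <= sup E by exact: sup_upper_bound.
apply: le_trans rE.
by case: Er => -[a b] _ <-; exact: sqrtr_ge0.
Qed.

Lemma spectral_radius_eigen_le A (r : R) : 0 <= r ->
  (forall z, eigenvalue (map_mx (real_complex R) A) z ->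
     ComplexField.Normc.normc z <= r) ->
  spectral_radius A <= r.
Proof.
move=> r0 Ar; rewrite /spectral_radius; set E := (X in sup X).
have [->|/set0P[s Es]] := eqVneq E set0; first by rewrite sup0.
apply: ge_sup; first by exists s.
by move=> _ [z zA <-]; exact: Ar.
Qed.

Lemma normc_sqr (a b : R) : ComplexField.Normc.normc (Complex a b) ^+ 2 = a ^+ 2 + b ^+ 2.
Proof. by rewrite sqr_sqrtr // addr_ge0 ?sqr_ge0. Qed.

(** A complex eigenvector splits as [x + i y] and its equation into two real ones, so that the real
    form [P] can be applied to both parts. *)
Lemma eigenvalue_complexP A (a b : R) :
  reflect (exists x y, [/\ (x != 0) || (y != 0),
             x *m A = a *: x - b *: y & y *m A = b *: x + a *: y])
    (eigenvalue (map_mx (real_complex R) A) (Complex a b)).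
Proof.
apply: (iffP eigenvalueP) => [[v vA v0]|[x [y [xy0 xA yA]]]].
  exists (map_mx (@complex.Re R) v), (map_mx (@complex.Im R) v); split.
  - apply: contraNT v0; rewrite negb_or !negbK => /andP[/eqP u0 /eqP w0].
    apply/eqP/rowP => i; move/rowP/(_ i): u0; move/rowP/(_ i): w0.
    by rewrite !mxE; case: (v 0 i) => p q /= -> ->.
  - apply/rowP => i; move/rowP/(_ i): vA; rewrite !mxE => /(congr1 (@complex.Re R)).
    rewrite raddf_sum /=; case: (v 0 i) => p q /= <-.
    apply: eq_bigr => j _; rewrite !mxE; case: (v 0 j) => p' q' /=.
    by rewrite mulr0 subr0.
  - apply/rowP => i; move/rowP/(_ i): vA; rewrite !mxE => /(congr1 (@complex.Im R)).
    rewrite raddf_sum /=; case: (v 0 i) => p q /=; rewrite addrC => <-.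
    apply: eq_bigr => j _; rewrite !mxE; case: (v 0 j) => p' q' /=.
    by rewrite mulr0 add0r.
exists (\row_i Complex (x 0 i) (y 0 i)).
  apply/rowP => i; rewrite !mxE; apply/eqP; rewrite eq_complex; apply/andP; split.
    rewrite raddf_sum /=; move/rowP/(_ i): xA; rewrite !mxE => <-.
    by apply/eqP/eq_bigr => j _; rewrite !mxE /= mulr0 subr0.
  rewrite raddf_sum /=; move/rowP/(_ i): yA; rewrite !mxE addrC => <-.
  by apply/eqP/eq_bigr => j _; rewrite !mxE /= mulr0 add0r.
apply: contraTneq xy0 => v0; rewrite negb_or !negbK; apply/andP; split;
  apply/eqP/rowP => i; move/rowP/(_ i): v0; rewrite !mxE => /eqP;
  by rewrite eq_complex => /andP[/eqP /= ? /eqP /= ?].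
Qed.

End SpectralRadius.

(** * Isometric subspaces and eigenvalues of modulus 1 *)

Section IsometricSubspace.
Variables (R : realType) (d : nat).
Implicit Types (P A : 'M[R]_d) (x y : 'rV[R]_d).

(** This is the Hermitian extension of [P] at the vector [x + i y] multiplied by [a + i b]; the
    cross terms cancel by symmetry. *)
Lemma rform_rotation P (a b : R) x y : symmetric_mx P ->
  let u := a *: x - b *: y in let v := b *: x + a *: y in
  rform P u u + rform P v v = (a ^+ 2 + b ^+ 2) * (rform P x x + rform P y y).
Proof.
move=> sP /=; rewrite -scaleNr !(rformDl, rformDr, rformZl, rformZr).
by rewrite (rformC y x sP); ring.
Qed.

(** Apply the contraction bound to the real and imaginary parts of an eigenvector, add, and divide
    by the sum of their forms, which is positive. *)
Lemma eigenvalue_normc_le P A (c : R) (z : R[i]) :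
  symmetric_mx P -> posdef_mx P ->
  (forall x, rform P (x *m A) (x *m A) <= c * rform P x x) ->
  eigenvalue (map_mx (real_complex R) A) z ->
  ComplexField.Normc.normc z ^+ 2 <= c.
Proof.
move=> sP pP cA; case: z => a b /eigenvalue_complexP [x [y [xy0 xA yA]]].
rewrite normc_sqr; have := lerD (cA x) (cA y).
rewrite xA yA rform_rotation // -mulrDr ler_pM2r //.
have := posdef_rform_ge0 x pP; have := posdef_rform_ge0 y pP.
case/orP: xy0 => /(posdef_rform pP) h hx hy; lra.
Qed.

Lemma spectral_radius_le P A (r : R) :
  symmetric_mx P -> posdef_mx P -> 0 <= r ->
  (forall x, rform P (x *m A) (x *m A) <= r ^+ 2 * rform P x x) ->
  spectral_radius A <= r.
Proof.
move=> sP pP r0 cA; apply: spectral_radius_eigen_le => // z zA.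
rewrite -ler_sqr ?nnegrE //; first exact: eigenvalue_normc_le sP pP cA zA.
by case: z {zA} => a b; exact: sqrtr_ge0.
Qed.

(** The restriction of [A] to the nonzero space [V] has a complex eigenvalue; as [A] preserves the
    form on both parts of the eigenvector, its modulus is 1. *)
Lemma isometric_stable_eigenvalue m P A (V : 'M[R]_(m, d)) :
  symmetric_mx P -> posdef_mx P -> V != 0 -> stablemx V A ->
  (forall x, (x <= V)%MS -> rform P (x *m A) (x *m A) = rform P x x) ->
  exists2 z : R[i], eigenvalue (map_mx (real_complex R) A) z
    & ComplexField.Normc.normc z = 1.
Proof.
move=> sP pP V0 VA iA; set B := row_base V.
have BA : (B *m A <= B)%MS.
  by rewrite (submx_trans _ (_ : V <= B)%MS) ?eq_row_base // (eqmxMr _ (eq_row_base V)).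
have BV x : (x <= B)%MS -> (x <= V)%MS by rewrite (eq_row_base V).
have r0 : (0 < \rank V)%N by rewrite lt0n mxrank_eq0.
(* [M] is the matrix of the restriction in the basis [B]. *)
set M := B *m A *m pinvmx B.
have MB : M *m B = B *m A by exact: mulmxKpV.
have [[a b] /eigenvalue_complexP[x [y [xy0 xM yM]]]] :=
  eigenvalue_closed (map_mx (real_complex R) M) r0.
have Bfree (w : 'rV_(\rank V)) : (w *m B != 0) = (w != 0).
  rewrite -[in LHS](mul0mx _ B) (inj_eq (row_free_inj _)) //.
  exact: row_base_free.
have xBA : x *m B *m A = a *: (x *m B) - b *: (y *m B).
  by rewrite -mulmxA -MB mulmxA xM mulmxBl -!scalemxAl.
have yBA : y *m B *m A = b *: (x *m B) + a *: (y *m B).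
  by rewrite -mulmxA -MB mulmxA yM mulmxDl -!scalemxAl.
have ab1 : a ^+ 2 + b ^+ 2 = 1.
  have := rform_rotation a b (x *m B) (y *m B) sP.
  rewrite /= -xBA -yBA !iA ?BV ?submxMl // => /esym/eqP.
  rewrite -subr_eq0 -[X in _ - X]mul1r -mulrBl mulf_eq0 subr_eq0 => /orP[/eqP //|].
  rewrite paddr_eq0 ?posdef_rform_ge0 // => /andP[/eqP hx /eqP hy].
  by case/orP: xy0; rewrite -Bfree => /(posdef_rform pP); rewrite ?hx ?hy ltxx.
exists (Complex a b).
  by apply/eigenvalue_complexP; exists (x *m B), (y *m B); rewrite !Bfree.
by rewrite /= ab1 sqrtr1.
Qed.

Lemma isometric_stable_spectral_radius_ge1 m P A (V : 'M[R]_(m, d)) :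
  symmetric_mx P -> posdef_mx P ->
  (forall x, rform P (x *m A) (x *m A) <= rform P x x) ->
  V != 0 -> stablemx V A ->
  (forall x, (x <= V)%MS -> rform P (x *m A) (x *m A) = rform P x x) ->
  1 <= spectral_radius A.
Proof.
move=> sP pP cA V0 VA iA.
have [z zA z1] := isometric_stable_eigenvalue sP pP V0 VA iA.
rewrite -z1; apply: sup_upper_bound; last exact: ex_intro2 (erefl _).
(* [sup] is known to dominate its elements once the set is nonempty and bounded; contraction
   supplies the bound 1. *)
split; first by exists (ComplexField.Normc.normc z); exact: ex_intro2 (erefl _).
exists 1 => _ [t tA <-]; rewrite -ler_sqr ?nnegrE ?expr1n //.
  apply: eigenvalue_normc_le sP pP _ tA => x; by rewrite mul1r.
by case: t {tA} => u v; exact: sqrtr_ge0.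
Qed.

End IsometricSubspace.

(** * Compactness: from strict to uniform contraction *)

Section StrictContraction.
Variables (R : realType) (d : nat) (P : 'M[R]_d).
Hypotheses (sP : symmetric_mx P) (pP : posdef_mx P).
Local Notation q x := (rform P x x).

Lemma rform_continuous (A : 'M[R]_d) :
  continuous (fun x : 'rV[R]_d => rform P (x *m A) (x *m A)).
Proof.
have -> : (fun x : 'rV[R]_d => rform P (x *m A) (x *m A)) =
    (fun x => \sum_j (\sum_i x 0 i * (A *m P *m A^T) i j) * x 0 j).
  apply/funext => x; rewrite rformM /rform mxE; apply: eq_bigr => j _.
  by rewrite !mxE.
set M := A *m P *m A^T.
have cj j : continuous (fun x : 'rV[R]_d => \sum_i x 0 i * M i j).
  apply: continuous_big => [|i _ x]; first exact: add_continuous.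
  by apply: continuousM; [exact: coord_continuous | exact: cst_continuous].
apply: continuous_big => [|j _ x]; first exact: add_continuous.
by apply: continuousM; [exact: cj | exact: coord_continuous].
Qed.

(** On the unit sphere of the ambient norm the loss [f] has a positive minimum and the form a
    positive maximum; their quotient is a uniform relative loss. *)
Lemma strict_contraction_uniform (A : 'M[R]_d) :
  (forall x, x != 0 -> rform P (x *m A) (x *m A) < q x) ->
  exists c : R, [/\ 0 <= c, c < 1 & forall x, rform P (x *m A) (x *m A) <= c * q x].
Proof.
move=> cA.
(* In dimension 0 the sphere is empty, so [c = 0] is given directly. *)
have [[x0 x00]|nx] := pselect (exists x : 'rV[R]_d, x != 0); last first.
  exists 0; split=> // x; have [->|x0] := eqVneq x 0.
    by rewrite /rform !mul0mx !mxE mulr0.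
  by case: nx; exists x.
pose D : set 'rV[R]_d := [set x | `|x| = 1]%classic.
have D0 : (D !=set0)%classic.
  exists (`|x0|^-1 *: x0); rewrite /D /= normrZ normfV normr_id mulVf //.
  by rewrite normr_eq0.
have cD : compact D.
  apply: bounded_closed_compact.
    by exists 1; split; [exact: num_real | move=> e e1 x /= ->; exact: ltW].
  apply: (@preimage_closed _ _ (fun x : 'rV[R]_d => `|x|) [set x | x = 1]%classic).
    by move=> x _; exact: norm_continuous.
  exact: closed_eq.
pose f x := q x - rform P (x *m A) (x *m A).
have q1 x : q x = rform P (x *m 1%:M) (x *m 1%:M) by rewrite mulmx1.
have cq : continuous (fun x : 'rV[R]_d => q x).
  by under eq_fun do rewrite q1; exact: rform_continuous.
have cf : continuous f.
  by move=> x; exact: cvgB (cq x) (@rform_continuous A x).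
have DN0 x : D x -> x != 0.
  by rewrite /D /= => x1; rewrite -normr_eq0 x1 oner_eq0.
have [a Da fa] := EVT_min_rV D0 cD (continuous_subspaceT cf).
have [b Db qb] := EVT_max_rV D0 cD (continuous_subspaceT cq).
move: Da Db; rewrite !inE => Da Db.
have f0 : 0 < f a by rewrite subr_gt0 cA ?DN0.
have q0 : 0 < q b by rewrite posdef_rform ?DN0.
have fq x : D x -> f a / q b * q x <= f x.
  move=> Dx; have Dx' : x \in D by rewrite inE.
  apply: le_trans (fa x Dx'); rewrite mulrAC ler_pdivrMr // ler_pM2l //.
  exact: qb.
(* Both sides are homogeneous of degree 2, so the bound on the sphere extends to every vector. *)
have fqx x : f a / q b * q x <= f x.
  have [->|x1] := eqVneq x 0; first by rewrite /f /rform !mul0mx !mxE subr0 mulr0.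
  pose n := `|x|; have n0 : 0 < n by rewrite normr_gt0.
  have [y Dy ->] : exists2 y, D y & x = n *: y.
    exists (n^-1 *: x); last by rewrite scalerA divff ?scale1r ?gt_eqF.
    by rewrite /D /= normrZ normfV normr_id mulVf ?gt_eqF.
  rewrite /f -scalemxAl !rformZl !rformZr -!mulrBr [X in X <= _]mulrCA.
  by rewrite ler_pM2l // [X in X <= _]mulrCA ler_pM2l //; exact: fq.
exists (Num.max 0 (1 - f a / q b)); split.
- by rewrite le_max lexx.
- by rewrite gt_max ltr01 gtrBl divr_gt0.
- move=> x; apply: (@le_trans _ _ ((1 - f a / q b) * q x)).
    by rewrite mulrBl mul1r lerBrDr addrC -lerBrDr; exact: fqx.
  by rewrite ler_wpM2r ?posdef_rform_ge0 // le_max lexx orbT.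
Qed.

End StrictContraction.

(** * Words in a contracting family *)

(** Transposition undoes the reversal in [word_prod]: on row vectors letters act in reading order,
    and a prefix of the word acts first. *)
Lemma trmx_word_prod (R : realType) (d : nat) (I : Type) (S : I -> 'M[R]_d) w :
  (word_prod S w)^T = \prod_(k <- w) (S k)^T.
Proof.
rewrite /word_prod; elim: w => [|k w IH]; first by rewrite !big_nil trmx1.
by rewrite rev_cons -cats1 big_cat big_seq1 trmx_mul IH big_cons.
Qed.

Lemma prod_flatten_nseq (R : realType) (d : nat) (I : Type)
    (T : I -> 'M[R]_d) w n :
  \prod_(k <- flatten (nseq n w)) T k = (\prod_(k <- w) T k) ^+ n.
Proof.
elim: n => [|n IH]; first by rewrite big_nil expr0.
by rewrite /= big_cat IH exprS.
Qed.

Lemma eigenvalueX (F : fieldType) n (A : 'M[F]_n) a m :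
  eigenvalue A a -> eigenvalue (A ^+ m) (a ^+ m).
Proof.
move=> /eigenvalueP[v vA v0]; apply/eigenvalueP; exists v => //.
elim: m => [|m IH]; first by rewrite !expr0 mulmx1 scale1r.
by rewrite exprSr mulmxA IH -scalemxAl vA scalerA -exprSr.
Qed.

Lemma normcX (R : rcfType) (z : R[i]) n :
  ComplexField.Normc.normc (z ^+ n) = ComplexField.Normc.normc z ^+ n.
Proof.
elim: n => [|n IH]; first by rewrite !expr0 ComplexField.Normc.normc1.
by rewrite !exprS ComplexField.Normc.normcM IH.
Qed.

Section ContractingFamily.
Variables (R : realType) (d : nat) (I : finType) (S : I -> 'M[R]_d).
Variable P : 'M[R]_d.
Hypotheses (sP : symmetric_mx P) (pP : posdef_mx P).
Hypothesis cS : forall k, nonneg_mx (P - (S k)^T *m P *m S k).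
Local Notation q x := (rform P x x).
Local Notation T k := (S k)^T.
Local Notation W w := (\prod_(k <- w) (S k)^T).

Lemma contraction_letter k x : q (x *m T k) <= q x.
Proof.
have := cS k x^T; rewrite rform_quad rformB subr_ge0.
by rewrite (rformM P (T k)) trmxK.
Qed.

Lemma contraction_word w x : q (x *m W w) <= q x.
Proof.
elim: w x => [|k w IH] x; first by rewrite big_nil mulmx1.
rewrite big_cons mulmxA; exact: le_trans (IH _) (contraction_letter _ _).
Qed.

Lemma contraction_blocks N c m w x :
  0 <= c ->
  (forall u x, size u = N -> q (x *m W u) <= c * q x) ->
  size w = (m * N)%N -> q (x *m W w) <= c ^+ m * q x.
Proof.
move=> c0 cN; elim: m w x => [|m IH] w x sw.
  by rewrite expr0 mul1r contraction_word.
rewrite -(cat_take_drop N w) big_cat mulmxA exprSr -mulrA.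
have sN : (N <= size w)%N by rewrite sw mulSn leq_addr.
apply: le_trans (IH _ _ _) _; first by rewrite size_drop sw mulSn addKn.
by rewrite ler_wpM2l ?exprn_ge0 // cN // size_takel.
Qed.

Lemma spectral_radius_word w :
  spectral_radius (word_prod S w) = spectral_radius (W w).
Proof. by rewrite -spectral_radius_tr trmx_word_prod. Qed.

Lemma spectral_radius_word_le1 w : spectral_radius (word_prod S w) <= 1.
Proof.
rewrite spectral_radius_word; apply: spectral_radius_le sP pP ler01 _ => x.
by rewrite expr1n mul1r contraction_word.
Qed.

Lemma max_word_radius_le n (C : R) : (0 < n)%N -> 0 <= C ->
  (forall w, size w = n -> spectral_radius (word_prod S w) <= C ^+ n) ->
  max_word_radius S n <= C.
Proof.
move=> n0 C0 wC; apply: bigmax_le => // w _.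
have -> : C = (C ^+ n) `^ n%:R^-1.
  by rewrite -powR_mulrn // -powRrM divff ?powRr1 // pnatr_eq0 -lt0n.
apply: ge0_ler_powR; rewrite ?nnegrE ?invr_ge0 ?ler0n ?exprn_ge0 //.
  exact: spectral_radius_ge0.
by apply: wC; rewrite size_tuple.
Qed.

Lemma max_word_radius_le1 n : (0 < n)%N -> max_word_radius S n <= 1.
Proof.
move=> n0; apply: max_word_radius_le => // w _.
by rewrite expr1n spectral_radius_word_le1.
Qed.

Lemma generalized_spectral_radius_lt1 N (c : R) : (0 < N)%N -> 0 <= c -> c < 1 ->
  (forall w x, size w = N -> q (x *m W w) <= c * q x) ->
  generalized_spectral_radius S < 1.
Proof.
move=> N0 c0 c1 cN.
(* The form is a squared norm: a factor [c] on it over [N] letters is a factor [C] on the norm per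
   letter. *)
pose C := c `^ (N * 2)%:R^-1.
have C0 : 0 <= C by exact: powR_ge0.
have CE : C ^+ (N * 2) = c.
  by rewrite -powR_mulrn // -powRrM mulVf ?powRr1 // pnatr_eq0 muln_eq0 negb_or -lt0n N0.
have C1 : C < 1.
  by rewrite ltNge; apply: contraTN c1 => C1; rewrite -leNgt -CE exprn_ege1.
apply: le_lt_trans C1; apply: ge_sup.
  by exists (max_word_radius S 1); exists 1%N.
move=> _ [n /= n0 <-]; apply: max_word_radius_le => // w sw.
rewrite spectral_radius_word; apply: spectral_radius_eigen_le => [|z zW].
  exact: exprn_ge0.
rewrite -(@ler_pXn2r _ (N * 2)) ?muln_gt0 ?N0 ?nnegrE ?exprn_ge0 //; last first.
  by case: z {zW} => u v; exact: sqrtr_ge0.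
rewrite exprAC CE exprM -normcX.
(* The length [n] of [w] may not be a multiple of [N], but [w] repeated [N] times splits into [n]
   blocks of length [N]. *)
apply: (eigenvalue_normc_le (A := W w ^+ N)) sP pP _ _.
  move=> x; rewrite -prod_flatten_nseq; apply: contraction_blocks c0 cN _.
  by rewrite size_flatten /shape map_nseq sumn_nseq sw.
rewrite rmorphXn; exact: eigenvalueX.
Qed.

(** Otherwise each of the finitely many words of length [N] contracts strictly, and the largest of
    their uniform constants, still below 1, pushes the generalized spectral radius below 1. *)
Lemma isometric_word N : (0 < N)%N -> generalized_spectral_radius S = 1 ->
  exists w x, [/\ size w = N, x != 0 & q (x *m W w) = q x].
Proof.
move=> N0 S1; apply: contrapT => nex.
have /choice[c cP] (w : N.-tuple I) : exists c : R,
    [/\ 0 <= c, c < 1 & forall x, q (x *m W w) <= c * q x].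
  apply: strict_contraction_uniform => // x x0.
  rewrite lt_neqAle contraction_word andbT; apply/eqP => qx.
  by apply: nex; exists w, x; rewrite size_tuple.
have : generalized_spectral_radius S < 1.
  apply: (@generalized_spectral_radius_lt1 N (\big[Num.max/0]_w c w)) => //.
  - exact: bigmax_ge_id.
  - by apply: bigmax_lt => // w _; have [] := cP w.
  - move=> w x /eqP sw; have [_ _ /(_ x)] := cP (Tuple sw).
    move=> /le_trans; apply; rewrite ler_wpM2r ?posdef_rform_ge0 //.
    exact: le_bigmax.
by rewrite S1 ltxx.
Qed.

End ContractingFamily.

(** * Trajectories that keep their norm *)

Section IsometricTrajectories.
Variables (R : realType) (d : nat) (I : finType) (S : I -> 'M[R]_d).
Variable P : 'M[R]_d.
Hypotheses (sP : symmetric_mx P) (pP : posdef_mx P).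
Hypothesis cS : forall k, nonneg_mx (P - (S k)^T *m P *m S k).
Local Notation q x := (rform P x x).
Local Notation W w := (\prod_(k <- w) (S k)^T).

Definition isometry_space (k : I) : 'M[R]_d :=
  kermx (P - (S k)^T *m P *m S k).

(** The matrix defining the kernel is a nonnegative form measuring the loss of [q] under [S k], and
    such a form vanishes only on its radical; hence the isometric vectors form a linear subspace. *)
Lemma isometry_spaceP k x :
  reflect (q (x *m (S k)^T) = q x) (x <= isometry_space k)%MS.
Proof.
have sM : symmetric_mx (P - (S k)^T *m P *m S k).
  by rewrite /symmetric_mx linearB /= !trmx_mul trmxK sP mulmxA.
have qM : rform (P - (S k)^T *m P *m S k) x x = q x - q (x *m (S k)^T).
  by rewrite rformB (rformM P) trmxK.
rewrite sub_kermx; apply: (iffP eqP) => [xM|xk].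
  by apply/esym/eqP; rewrite -subr_eq0 -qM /rform xM mul0mx mxE.
by apply: nonneg_rform_eq0 => //; rewrite qM xk subrr.
Qed.

Lemma word_isometry_ge1 m (V : 'M[R]_(m, d)) w :
  V != 0 -> stablemx V (W w) ->
  (forall x, (x <= V)%MS -> q (x *m W w) = q x) ->
  1 <= spectral_radius (word_prod S w).
Proof.
move=> V0 VW iW; rewrite spectral_radius_word.
exact: (isometric_stable_spectral_radius_ge1 sP pP (contraction_word cS w) V0).
Qed.

(** The form never increases along a word, so equality at the end forces equality after every
    prefix. *)
Lemma isometric_word_prefix w x t :
  q (x *m W w) = q x -> q (x *m W (take t w)) = q x.
Proof.
move=> qx; apply/eqP; rewrite eq_le contraction_word //= -[X in X <= _]qx.
have -> : W w = W (take t w) *m W (drop t w).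
  by rewrite -[in LHS](cat_take_drop t w) big_cat.
by rewrite mulmxA contraction_word.
Qed.

Lemma isometric_word_letter k0 w x t :
  q (x *m W w) = q x -> (t < size w)%N ->
  (x *m W (take t w) <= isometry_space (nth k0 w t))%MS.
Proof.
move=> qx tw; apply/isometry_spaceP.
rewrite (isometric_word_prefix t qx) -(isometric_word_prefix t.+1 qx).
by rewrite (take_nth k0) // -cats1 big_cat big_seq1 mulmxA.
Qed.

(** Both visits lie on one line, so the word between them maps this line to itself isometrically. *)
Lemma isometric_cycle m (U : 'M[R]_(m, d)) w x i j :
  x != 0 -> q (x *m W w) = q x -> (i < j)%N -> (\rank U <= 1)%N ->
  (x *m W (take i w) <= U)%MS -> (x *m W (take j w) <= U)%MS ->
  1 <= spectral_radius (word_prod S (drop i (take j w))).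
Proof.
move=> x0 qx ij U1; set y := x *m W (take i w); set u := drop i (take j w) => yU.
have Wj : W (take j w) = W (take i w) *m W u.
  by rewrite -[in LHS](cat_take_drop i (take j w)) big_cat take_takel // ltnW.
rewrite Wj mulmxA -/y => zU.
have qy : q y = q x by exact: isometric_word_prefix.
have qz : q (y *m W u) = q y.
  by rewrite qy -(isometric_word_prefix j qx) Wj mulmxA.
have y0 : y != 0.
  apply: contraTneq (posdef_rform pP x0) => y0.
  by rewrite -qy y0 /rform !mul0mx mxE ltxx.
have Uy : (U <= y)%MS.
  rewrite -(mxrank_leqif_sup yU) eqn_leq mxrankS //=.
  by apply: leq_trans U1 _; rewrite lt0n mxrank_eq0.
apply: (word_isometry_ge1 y0); first exact: submx_trans zU Uy.
move=> _ /sub_rVP[a ->].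
by rewrite -scalemxAl !rformZl !rformZr qz.
Qed.


Lemma isometry_space_full k : (0 < d)%N -> row_full (isometry_space k) ->
  1 <= spectral_radius (word_prod S [:: k]).
Proof.
move=> d0 fk; apply: (word_isometry_ge1 (V := isometry_space k)).
- by rewrite -mxrank_eq0 (eqP fk) -lt0n.
- exact: submx_full.
- by move=> x /isometry_spaceP; rewrite big_seq1.
Qed.

(* Between two letters i, j of the word, an isometric trajectory lies here. *)
Definition passage_space (i j : I) : 'M[R]_d :=
  (isometry_space i *m (S i)^T :&: isometry_space j)%MS.

Lemma isometric_word_passage k0 w x t :
  q (x *m W w) = q x -> (t.+1 < size w)%N ->
  (x *m W (take t.+1 w) <= passage_space (nth k0 w t) (nth k0 w t.+1))%MS.
Proof.
move=> qx tw; rewrite sub_capmx isometric_word_letter // andbT.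
rewrite (take_nth k0) 1?ltnW // -cats1 big_cat big_seq1 mulmxA submxMr //.
by apply: isometric_word_letter; rewrite 1?ltnW.
Qed.

(** The passage space sits inside the image of [isometry_space i], of rank at most [r]; with rank
    [r] it fills that image. *)
Lemma passage_space_rank i j r :
  (\rank (isometry_space i) <= r)%N ->
  (r <= \rank (passage_space i j))%N ->
  (isometry_space i *m (S i)^T <= isometry_space j)%MS.
Proof.
set A := isometry_space i *m (S i)^T => ri rU.
apply: submx_trans (capmxSr A (isometry_space j)).
rewrite -(mxrank_leqif_sup (capmxSl A (isometry_space j))).
rewrite eqn_leq mxrankS ?capmxSl //=.
exact: leq_trans (mxrankM_maxl _ _) (leq_trans ri rU).
Qed.

End IsometricTrajectories.

(** * Two matrices: repetitions in words, dimensions 2 and 3 *)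

(** Nine letters contain eight consecutive pairs. The excluded pair [b], [~~ b] never occurs at
    adjacent positions, so at least four pairs are of the three other kinds, and one kind repeats.
    The gap bound 6 is left to enumeration. *)
Lemma pigeonhole_passages (l : seq bool) b : size l = 9 ->
  exists s t, [/\ (s < t)%N, (t <= s + 6)%N, (t <= 7)%N &
    [/\ nth b l s = nth b l t, nth b l s.+1 = nth b l t.+1 &
       (nth b l s != b) || (nth b l s.+1 == b)]].
Proof.
pose good (l : seq bool) (p : nat * nat) := [&& (p.1 < p.2)%N, (p.2 <= p.1 + 6)%N,
  (p.2 <= 7)%N, nth b l p.1 == nth b l p.2, nth b l p.1.+1 == nth b l p.2.+1 &
  (nth b l p.1 != b) || (nth b l p.1.+1 == b)].
move=> sl; suff /hasP[[s t] _ /and5P[st ts t7 /eqP n1 /andP[/eqP n2 n3]]] :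
  has (good l) (allpairs pair (iota 0 8) (iota 0 8)) by exists s, t.
case: l sl => [|b0 [|b1 [|b2 [|b3 [|b4 [|b5 [|b6 [|b7 [|b8 []]]]]]]]]] // _.
(* [b] and the nine letters leave 2^10 cases, each settled by computation. *)
rewrite {}/good; case: b b0 b1 b2 b3 b4 b5 b6 b7 b8.
by do 9!case.
by do 9!case.
Qed.

Lemma ord2P (i : 'I_2) : i = ord0 \/ i = ord_max.
Proof.
case: (unliftP ord0 i) => [j|] ->; last by left.
by right; rewrite ord1; exact: val_inj.
Qed.

Section TwoMatrices.
Variables (R : realType) (d : nat) (S : 'I_2 -> 'M[R]_d) (P : 'M[R]_d).
Hypotheses (sP : symmetric_mx P) (pP : posdef_mx P).
Hypothesis cS : forall k, nonneg_mx (P - (S k)^T *m P *m S k).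
Hypothesis S1 : generalized_spectral_radius S = 1.
Local Notation q x := (rform P x x).
Local Notation W w := (\prod_(k <- w) (S k)^T).
Local Notation V k := (isometry_space S P k).
Local Notation U i j := (passage_space S P i j).
Local Notation radius1 w := (1 <= spectral_radius (word_prod S w)).

Lemma isometry_space_rank k :
  (0 < d)%N -> ~~ radius1 [:: k] -> (\rank (V k) <= d.-1)%N.
Proof.
move=> d0; apply: contraR; rewrite -ltnNge prednK // => rk.
apply: (isometry_space_full sP pP cS) => //.
by rewrite /row_full eqn_leq rank_leq_col.
Qed.

(** If both single letters fail, the isometry spaces have rank at most 1, so any letter occurring
    twice closes a cycle. *)
Lemma dim2_radius1 : d = 2%N ->
  exists2 w, w \in [:: [:: ord0]; [:: ord_max]; [:: ord_max; ord0]] & radius1 w.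
Proof.
move=> d2; have d0 : (0 < d)%N by rewrite d2.
apply: contrapT => nex.
have nk k : ~~ radius1 [:: k].
  apply/negP => rk; apply: nex; exists [:: k]; last exact: rk.
  by case: (ord2P k) => ->; rewrite !inE eqxx ?orbT.
have rV k : (\rank (V k) <= 1)%N.
  have d1 : d.-1 = 1%N by rewrite d2.
  by rewrite -[leqRHS]d1 isometry_space_rank.
apply: nex; exists [:: ord_max; ord0]; first by rewrite !inE eqxx !orbT.
(* With length 4, an alternating word contains [ord_max], [ord0], [ord_max] whichever letter comes
   first; this fixes the order of the product. *)
have [w [x [sw x0 qx]]] := isometric_word sP pP cS (isT : 0 < 4)%N S1.
have xV t : (t < 4)%N -> (x *m W (take t w) <= V (nth ord0 w t))%MS.
  by move=> t4; apply: isometric_word_letter; rewrite ?sw.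
have rep i j : (i < j)%N -> (j < 4)%N -> nth ord0 w i = nth ord0 w j ->
    radius1 (drop i (take j w)).
  move=> ij j4 wij; apply: (isometric_cycle sP pP cS x0 qx ij (rV (nth ord0 w j))).
    by rewrite -wij xV // (ltn_trans ij).
  exact: xV.
(* Equal neighbours would close a cycle of one letter, against [nk]. *)
have alt t : (t < 3)%N -> nth ord0 w t != nth ord0 w t.+1.
  move=> t3; apply/negP => /eqP /(rep _ _ (ltnSn t) t3).
  have -> : drop t (take t.+1 w) = [:: nth ord0 w t].
    have tw : (t < size w)%N by rewrite sw ltnW.
    by rewrite (take_nth ord0) // -cats1 drop_size_cat // size_takel // ltnW.
  by apply/negP; exact: nk.
have [i [i2 wi wi1 wi2]] : exists i, [/\ (i < 2)%N, nth ord0 w i = ord_max,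
    nth ord0 w i.+1 = ord0 & nth ord0 w i.+2 = ord_max].
  have := alt 0%N isT; have := alt 1%N isT; have := alt 2%N isT.
  case: (ord2P (nth ord0 w 0)) => w0; case: (ord2P (nth ord0 w 1)) => w1;
    case: (ord2P (nth ord0 w 2)) => w2; case: (ord2P (nth ord0 w 3)) => w3;
    rewrite w0 w1 w2 w3 ?eqxx // => _ _ _; [by exists 1%N | by exists 0%N].
have := rep i i.+2 (ltnW (ltnSn i.+1)) (i2 : i.+2 < 4)%N; rewrite wi wi2.
have -> : drop i (take i.+2 w) = [:: ord_max; ord0].
  have iw : (i.+1 < size w)%N by rewrite sw ltnW.
  rewrite (take_nth ord0) // (take_nth ord0) 1?ltnW // wi wi1.
  by rewrite -!cats1 -catA drop_size_cat // size_takel // ltnW // ltnW.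
exact.
Qed.

(** A plane [U i i] makes [V i] stable under the letter [i]; planes [U i j] and [U j i] together
    make [V i] stable under the word [i j]. So at most one pair, of distinct letters, is
    exceptional, and [b] tells whether it starts with [ord0]. *)
Lemma dim3_passage_rank : d = 3%N ->
  (forall w, (0 < size w <= 6)%N -> ~~ radius1 w) ->
  exists b : bool, forall i j : 'I_2,
    ((i == ord0) != b) || ((j == ord0) == b) -> (\rank (U i j) <= 1)%N.
Proof.
move=> d3 nr; have d0 : (0 < d)%N by rewrite d3.
have rV k : (\rank (V k) <= 2)%N.
  have d1 : d.-1 = 2%N by rewrite d3.
  by rewrite -[leqRHS]d1 isometry_space_rank ?nr.
have UV i j : (1 < \rank (U i j))%N -> (V i *m (S i)^T <= V j)%MS.
  exact: passage_space_rank.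
have V0 i j : (1 < \rank (U i j))%N -> V i != 0.
  apply: contraTneq => Vi0.
  by rewrite /passage_space Vi0 mul0mx cap0mx mxrank0.
have Uii i : (\rank (U i i) <= 1)%N.
  rewrite leqNgt; apply: contraL (nr [:: i] isT) => ri; rewrite negbK.
  apply: (word_isometry_ge1 sP pP cS (V0 _ _ ri)); rewrite big_seq1.
    exact: UV.
  by move=> x /(isometry_spaceP sP cS).
have Uij i j : (1 < \rank (U i j))%N -> (\rank (U j i) <= 1)%N.
  move=> ri; rewrite leqNgt; apply: contraL (nr [:: i; j] isT) => rj.
  rewrite negbK; apply: (word_isometry_ge1 sP pP cS (V0 _ _ ri));
    rewrite big_cons big_seq1.
    by rewrite mulmxA (submx_trans (submxMr _ (UV _ _ ri))) ?UV.
  move=> x xi; rewrite mulmxA.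
  have /(isometry_spaceP sP cS) -> : (x *m (S i)^T <= V j)%MS.
    exact: submx_trans (submxMr _ xi) (UV _ _ ri).
  exact/(isometry_spaceP sP cS).
have [r01|r01] := ltnP 1 (\rank (U ord0 ord_max)).
  by exists true => i j; case: (ord2P i) => ->; case: (ord2P j) => -> //= _;
    rewrite ?Uii // Uij.
by exists false => i j; case: (ord2P i) => ->; case: (ord2P j) => -> //= _;
  rewrite ?Uii.
Qed.

Lemma dim3_radius1 : d = 3%N ->
  exists2 w, (0 < size w <= 6)%N & radius1 w.
Proof.
move=> d3; apply: contrapT => nex.
have nr w : (0 < size w <= 6)%N -> ~~ radius1 w.
  by move=> sw; apply/negP => rw; apply: nex; exists w.
have [b rU] := dim3_passage_rank d3 nr.
have [w [x [sw x0 qx]]] := isometric_word sP pP cS (isT : 0 < 9)%N S1.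
have [|s [t [st ts t7 [n1 n2 n3]]]] :=
  @pigeonhole_passages [seq i == ord0 | i <- w] b; first by rewrite size_map.
have t9 : (t.+1 < size w)%N by rewrite sw.
have s9 : (s.+1 < size w)%N by rewrite (leq_trans _ t9) // ltnS ltnS ltnW.
have eq0_inj (i j : 'I_2) : (i == ord0) = (j == ord0) -> i = j.
  by case: (ord2P i) => ->; case: (ord2P j) => ->.
move: n1 n2 n3; have t8 := ltnW t9; have s8 := ltnW s9.
rewrite !(nth_map ord0) // => /eq0_inj n1 /eq0_inj n2 n3.
(* A passage space is reached after its first letter, so the cycle consists of the letters at
   positions [s.+1] to [t]. *)
have sizes : size (drop s.+1 (take t.+1 w)) = (t - s)%N.
  by rewrite size_drop size_takel 1?ltnW // subSS.
have u6 : (0 < size (drop s.+1 (take t.+1 w)) <= 6)%N.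
  by rewrite sizes subn_gt0 st leq_subLR.
apply: (negP (nr _ u6)).
apply: (isometric_cycle sP pP cS x0 qx _ (rU _ _ n3)) => //.
  exact: isometric_word_passage.
by rewrite n1 n2; exact: isometric_word_passage.
Qed.

End TwoMatrices.

(** * Both dimensions: upper bounds by contraction, lower bounds by a cycle *)

Theorem mainTheorem5 (R : realType) (d : nat) (S : 'I_2 -> 'M[R]_d) :
  (exists P : 'M[R]_d, [/\ symmetric_mx P, posdef_mx P &
     forall k : 'I_2, nonneg_mx (P - (S k)^T *m P *m S k)]) ->
  generalized_spectral_radius S = 1 ->
  (d = 2%N ->
     1 = Num.max (Num.max (spectral_radius (S ord0))
                          (spectral_radius (S ord_max)))
                 (Num.sqrt (spectral_radius (S ord0 *m S ord_max)))) /\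
  (d = 3%N ->
     1 = \big[Num.max/0]_(n <- [:: 1; 2; 3; 4; 5; 6; 8]%N)
           max_word_radius S n).
Proof.
move=> [P [sP pP cS]] S1.
have le1 w : spectral_radius (word_prod S w) <= 1.
  exact: spectral_radius_word_le1 sP pP cS w.
have word1 k : word_prod S [:: k] = S k by rewrite /word_prod big_seq1.
have word2 : word_prod S [:: ord_max; ord0] = S ord0 *m S ord_max.
  by rewrite /word_prod /rev /= big_cons big_seq1.
split=> [d2|d3]; apply/le_anti/andP; split.
- have [w] := dim2_radius1 sP pP cS S1 d2.
  rewrite !inE => /or3P[] /eqP -> r1; rewrite !le_max.
  + by apply/orP; left; apply/orP; left; rewrite -word1; exact: r1.
  + by apply/orP; left; apply/orP; right; rewrite -word1; exact: r1.
  + apply/orP; right; rewrite -word2 -[leLHS]sqrtr1; apply: ler_wsqrtr; exact: r1.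
- rewrite !ge_max -andbA; apply/and3P; split.
  + by rewrite -word1; exact: le1.
  + by rewrite -word1; exact: le1.
  + by rewrite -word2 -[leRHS]sqrtr1; apply: ler_wsqrtr; exact: le1.
- have [w /andP[w0 w6] r1] := dim3_radius1 sP pP cS S1 d3.
  apply: (bigmax_sup_seq _ (size w)) => //.
    by move: w0 w6; case: (size w) => [|[|[|[|[|[|[|n]]]]]]].
  apply: (bigmax_sup (in_tuple w)) => //.
  have e1 : 1 `^ (size w)%:R^-1 = 1 :> R by rewrite powR1.
  rewrite -[leLHS]e1.
  apply: ge0_ler_powR; rewrite ?nnegrE ?invr_ge0 ?ler0n ?ler01 //.
  exact: spectral_radius_ge0.
(* [big_seq] keeps the membership of [n] in the list, which excludes [n = 0]. *)
- rewrite big_seq; apply: bigmax_le => // n n7.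
  by apply: (max_word_radius_le1 sP pP cS); case: n n7.
Qed.
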